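(* Let $C_1=\sum_{P} q^{\text{area of }P}$, where the sum runs over all level one cheesy polyominoes $P$ (on the hexagonal tiling, counted up to translation). Then, as a formal power series in $q$, $$C_1=\frac{q(1-3q+q^2)}{1-6q+8q^2-q^3}.$$
   Context: Consider the regular hexagonal tiling of the Euclidean plane, oriented so that every hexagonal tile has two horizontal edges; tiles are called cells. A (hexagonal-celled) polyomino is a union of finitely many (at least one) cells whose interior is connected (for unions of hexagonal cells, this is equivalent to the union being connected). Two polyominoes are considered equal if and only if one is the image of the other under a translation. The area of a polyomino is its number of cells. The cells of a polyomino $P$ are partitioned according to their horizontal projection (cells with the same projection onto the horizontal axis lie in the same block); each block is a column of $P$. Cells of the tiling with the same horizontal projection are stacked vertically, consecutive ones sharing a horizontal edge. A column need not be a connected set; its connected components are its maximal runs of vertically consecutive cells. If a column has two connected components, the gap (hole) between them is the set of cells of the tiling lying in that vertical stack strictly between the two components. Columns are ordered from left to right; the first column is the leftmost one, and two columns are adjacent if they are consecutive in this order. A polyomino $P$ is rightward-semi-directed if the first (leftmost) column of $P$ has no gap (i.e. is connected) and, in every pair of adjacent columns of $P$, every connected component of the right column has at least one edge in common with the left column. For an integer $m\ge 1$, a polyomino $P$ is a level $m$ cheesy polyomino if: (i) $P$ is rightward-semi-directed; (ii) every column of $P$ has at most two connected components; (iii) if a column of $P$ has two connected components, then the gap between the components consists of at most $m$ cells. *)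

(* Defs.v *)
From HB Require Import structures.
From mathcomp Require Import all_boot all_order all_algebra finmap.
From mathcomp Require Import boolp classical_sets functions cardinality.

Set Implicit Arguments.
Unset Strict Implicit.
Unset Printing Implicit Defensive.

Import Order.TTheory GRing.Theory Num.Theory.
Local Open Scope ring_scope.

(* The ring R[[q]].  A record is used, rather than nat -> R, because functions
   already carry the pointwise product. *)
Record fps (R : Type) := Fps { fcoef : nat -> R }.

Section FpsEq.
Variable R : Type.
HB.instance Definition _ := gen_eqMixin (fps R).
HB.instance Definition _ := gen_choiceMixin (fps R).

Lemma fpsP (a b : fps R) : fcoef a =1 fcoef b -> a = b.
Proof. by case: a b => [a] [b] /= ab; congr Fps; apply: funext. Qed.
End FpsEq.

Section FpsRing.
Variable R : comNzRingType.
Implicit Types a b c : fps R.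

Definition fps_zero : fps R := Fps (fun=> 0).
Definition fps_one : fps R := Fps (fun n => (n == 0%N)%:R).
Definition fps_opp a : fps R := Fps (fun n => - fcoef a n).
Definition fps_add a b : fps R := Fps (fun n => fcoef a n + fcoef b n).
Definition fps_mul a b : fps R :=
  Fps (fun n => \sum_(i < n.+1) fcoef a i * fcoef b (n - i)%N).

Fact fps_addA : associative fps_add.
Proof. by move=> a b c; apply: fpsP => n /=; rewrite addrA. Qed.
Fact fps_addC : commutative fps_add.
Proof. by move=> a b; apply: fpsP => n /=; rewrite addrC. Qed.
Fact fps_add0 : left_id fps_zero fps_add.
Proof. by move=> a; apply: fpsP => n /=; rewrite add0r. Qed.
Fact fps_addN : left_inverse fps_zero fps_opp fps_add.
Proof. by move=> a; apply: fpsP => n /=; rewrite addNr. Qed.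

HB.instance Definition _ :=
  GRing.isZmodule.Build (fps R) fps_addA fps_addC fps_add0 fps_addN.

Let trunc m a : {poly R} := \poly_(i < m) fcoef a i.

Let fps_mul_trunc m n a b : (n < m)%N ->
  fcoef (fps_mul a b) n = (trunc m a * trunc m b)`_n.
Proof.
move=> nm; rewrite coefM; apply: eq_bigr => i _; rewrite !coef_poly.
have le_in : (i <= n)%N by rewrite -ltnS.
by rewrite (leq_ltn_trans le_in nm) (leq_ltn_trans (leq_subr i n) nm).
Qed.

Fact fps_mulC : commutative fps_mul.
Proof. by move=> a b; apply: fpsP => n; rewrite !(@fps_mul_trunc n.+1) // mulrC. Qed.

Fact fps_mulA : associative fps_mul.
Proof.
move=> a b c; apply: fpsP => n; rewrite !(@fps_mul_trunc n.+1) //.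
have tr d e i : (i < n.+1)%N ->
    (trunc n.+1 (fps_mul d e))`_i = (trunc n.+1 d * trunc n.+1 e)`_i.
  by move=> lt_in; rewrite coef_poly lt_in (@fps_mul_trunc n.+1).
transitivity ((trunc n.+1 a * trunc n.+1 b * trunc n.+1 c)`_n).
  rewrite -mulrA [LHS]coefM [RHS]coefM; apply: eq_bigr => i _.
  by rewrite tr // ltnS leq_subr.
by rewrite [LHS]coefM [RHS]coefM; apply: eq_bigr => i _; rewrite tr.
Qed.

Fact fps_mul1 : left_id fps_one fps_mul.
Proof.
move=> a; apply: fpsP => n /=; rewrite big_ord_recl /= subn0 mul1r.
by rewrite big1 ?addr0 // => i _; rewrite mul0r.
Qed.

Fact fps_mulDl : left_distributive fps_mul fps_add.
Proof.
move=> a b c; apply: fpsP => n /=; rewrite -big_split /=.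
by apply: eq_bigr => i _; rewrite mulrDl.
Qed.

Fact fps_oner_neq0 : fps_one != 0.
Proof.
apply/eqP => /(congr1 (fun a => fcoef a 0%N)) /= /eqP.
by rewrite oner_eq0.
Qed.

HB.instance Definition _ := GRing.Zmodule_isComNzRing.Build (fps R)
  fps_mulA fps_mulC fps_mul1 fps_mulDl fps_oner_neq0.

(* Noncomputable: the units are the series that have an inverse, and fps_inv
   picks it (and is the identity elsewhere, as in any unitRingType). *)
Definition fps_unit : {pred fps R} := fun a => `[< exists b, b * a = 1 >].
Definition fps_inv a : fps R := xget a [set b | b * a = 1]%classic.

Fact fps_mulVr : {in fps_unit, left_inverse 1 fps_inv *%R}.
Proof. by move=> a /asboolP ab; rewrite /fps_inv; apply: (xgetPex a ab). Qed.
Fact fps_unitP a b : b * a = 1 -> fps_unit a.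
Proof. by move=> ba; apply/asboolP; exists b. Qed.
Fact fps_inv_out : {in [predC fps_unit], fps_inv =1 id}.
Proof.
move=> a /asboolP ab; apply: xgetPN => b ba.
by apply: ab; exists b.
Qed.

HB.instance Definition _ := GRing.ComNzRing_hasMulInverse.Build (fps R)
  fps_mulVr fps_unitP fps_inv_out.

Definition fpsX : fps R := Fps (fun n => (n == 1%N)%:R).
End FpsRing.

Section FpsUnit.
Variable R : comNzRingType.
Implicit Types a b e : fps R.

Let fps_exp_lt e m n : fcoef e 0%N = 0 -> (n < m)%N -> fcoef (e ^+ m) n = 0.
Proof.
move=> e0; elim: m n => // m IH n nm.
rewrite exprS -[LHS]/(\sum_(i < n.+1) fcoef e i * fcoef (e ^+ m) (n - i)).
rewrite big1 // => -[[|i] /= lt_i] _; first by rewrite e0 mul0r.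
rewrite IH ?mulr0 //; apply: leq_trans (nm : (n <= m)%N).
by rewrite ltn_subrL /=; case: (n) lt_i.
Qed.

Lemma fps_unit1 a : fcoef a 0%N = 1 -> a \is a GRing.unit.
Proof.
move=> a0; pose e := 1 - a; pose S m := \sum_(k < m) e ^+ k.
have e0 : fcoef e 0%N = 0 by rewrite -[LHS]/(1 - fcoef a 0%N) a0 subrr.
have Sm m n : (n < m)%N -> fcoef (S m) n = fcoef (S n.+1) n.
  move=> /subnK <-; elim: (m - n.+1)%N => //= k <-.
  rewrite addSn /S big_ord_recr /=.
  rewrite -[LHS]/(fcoef _ n + fcoef _ n) fps_exp_lt ?addr0 //.
  by rewrite addnS ltnS leq_addl.
apply/asboolP; exists (Fps (fun n => fcoef (S n.+1) n)); rewrite mulrC.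
apply: fpsP => n; transitivity (fcoef (a * S n.+1) n).
  apply: eq_bigr => i _; congr (_ * _).
  by rewrite [RHS]Sm //= ltnS leq_subr.
have -> : a * S n.+1 = 1 - e ^+ n.+1.
  by rewrite -[X in X - _](expr1n _ n.+1) subrXX opprB addrC subrK; congr (_ * _);
     apply: eq_bigr => i _; rewrite expr1n mul1r.
by rewrite -[LHS]/(fcoef 1 n - fcoef (e ^+ n.+1) n) fps_exp_lt ?subr0.
Qed.
End FpsUnit.

(* Axial coordinates for hexagons of side 1 with two horizontal edges: the cell
   (x, y) has its centre at (3x/2, sqrt 3 * (y + x/2)).  The first coordinate
   thus identifies the horizontal projection, and the second one numbers the
   cells of a vertical stack from bottom to top.  The translations preserving
   the tiling are exactly the maps c |-> c + v with v : cell. *)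
Notation cell := (int * int)%type.

Definition hex_adj : rel cell := fun c d =>
  d - c \in [:: (0, 1); (0, -1); (1, 0); (1, -1); (-1, 0); (-1, 1)].

(* A union of finitely many cells is represented by its set of cells. *)
Definition hex_connect (S : {fset cell}) : rel S :=
  connect (fun c d : S => hex_adj (val c) (val d)).

Definition hex_connected (S : {fset cell}) : Prop :=
  forall c d : S, hex_connect c d.

Definition components (S : {fset cell}) : {fset {fset cell}} :=
  [fset [fset val d | d in hex_connect c] | c in {: S}]%fset.

Definition polyomino (P : {fset cell}) : Prop :=
  P != fset0%fset /\ hex_connected P.

Definition column (P : {fset cell}) (x : int) : {fset cell} :=
  [fset c in P | c.1 == x]%fset.

(* x is the position of a column of P *)
Definition has_column (P : {fset cell}) (x : int) : Prop :=
  column P x != fset0%fset.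

Definition first_column (P : {fset cell}) (x : int) : Prop :=
  has_column P x /\ forall x', has_column P x' -> x <= x'.

Definition adjacent_columns (P : {fset cell}) (x x' : int) : Prop :=
  [/\ has_column P x, has_column P x', x < x' &
      forall z, has_column P z -> ~~ (x < z < x')].

Definition share_edge (K L : {fset cell}) : Prop :=
  exists c d, [/\ c \in K, d \in L & hex_adj c d].

Definition rightward_semi_directed (P : {fset cell}) : Prop :=
  (forall x, first_column P x -> hex_connected (column P x)) /\
  (forall x x', adjacent_columns P x x' ->
     forall K, K \in components (column P x') -> share_edge K (column P x)).

(* The cells of the stack x lying above K and below L; it is empty when K is
   not below L. *)
Definition gap (x : int) (K L : {fset cell}) : set cell :=
  [set c : cell | [/\ c.1 = x, forall k, k \in K -> k.2 < c.2
                      & forall l, l \in L -> c.2 < l.2]]%classic.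

Definition cheesy (m : nat) (P : {fset cell}) : Prop :=
  [/\ polyomino P,
      rightward_semi_directed P,
      forall x, (#|` components (column P x)| <= 2)%N
    & forall x (K L : {fset cell}), K \in components (column P x) ->
        L \in components (column P x) -> K != L -> (gap x K L #<= `I_m)%card].

Definition translate (v : cell) (P : {fset cell}) : {fset cell} :=
  [fset (c + v)%R | c in P]%fset.

Definition translation_class (P : {fset cell}) : set {fset cell} :=
  [set translate v P | v in [set: cell]]%classic.

Definition cheesy_classes (m n : nat) : set (set {fset cell}) :=
  [set translation_class P | P in [set P | cheesy m P /\ #|` P| = n]]%classic.

(* There are finitely many classes of each area, so fset_set, which is empty on
   infinite sets, does enumerate them. *)
Definition cheesy_gf (m : nat) : fps int :=
  Fps (fun n => (#|` fset_set (cheesy_classes m n)|)%:Z).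

(* Main.v *)
Require Import Defs.
From mathcomp Require Import all_boot all_order all_algebra.
From mathcomp Require Import finmap zify ring.
From mathcomp Require Import boolp classical_sets functions cardinality.
Import Order.TTheory GRing.Theory Num.Theory.
Local Open Scope ring_scope.

(* A cheesy polyomino is built column by column from the left.  Since gaps have
   one cell only, the cells to the right of a column that share an edge with it
   are consecutive, and there are l = k + 1 or l = k + 2 of them if the column
   has k cells in one or in two components.  A connected column of k cells can
   be appended in l + k - 1 ways.  One with two components, of a and k - a cells,
   can be appended in l - 2 ways, since its gap has to be one of the l cells
   other than the two extreme ones.  So the number of ways to append columns with
   n cells in all depends on n and l only and, by these formulas, has the form
   a_n + l b_n.  The generating functions of (a_n) and (b_n) satisfy a linear
   system of size two, whose coefficients are the series of k^i q^k, i <= 2. *)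

(** * Connectivity *)

Lemma hex_adjE (c d : cell) : hex_adj c d =
  [|| (d.1 == c.1) && ((d.2 == c.2 + 1) || (d.2 == c.2 - 1)),
      (d.1 == c.1 + 1) && ((d.2 == c.2) || (d.2 == c.2 - 1))
    | (d.1 == c.1 - 1) && ((d.2 == c.2) || (d.2 == c.2 + 1))].
Proof.
case: c d => [x y] [x' y']; rewrite /hex_adj /= !inE !xpair_eqE /=.
lia.
Qed.

Lemma hex_adj_sym : symmetric hex_adj.
Proof. by move=> c d; rewrite !hex_adjE; lia. Qed.

(* Stated by quantification over closed predicates, so as not to deal with the
   subtype of the cells in S, on which hex_connect is defined. *)
Definition reach (S : {fset cell}) (c d : cell) : Prop :=
  [/\ c \in S, d \in S & forall A : pred cell,
    (forall u v, u \in S -> v \in S -> hex_adj u v -> A u -> A v) -> A c -> A d].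

Lemma hex_connectP (S : {fset cell}) (c d : S) :
  hex_connect c d <-> reach S (val c) (val d).
Proof.
(* For the converse, the closed predicate is that of being the value of some cell of [S] connected
   to [c]. *)
split=> [/connectP[p] | [_ _ /(_ (fun z => [exists z' : S, (val z' == z) && hex_connect c z']))]].
  elim: p c => [|e p IH] c /= => [_ ->|/andP[ce ep] dE].
    by split; [exact: fsvalP|exact: fsvalP|].
  have [_ dS ed] := IH e ep dE; split=> // A clA Ac.
  by apply: (ed A clA); apply: clA ce Ac; exact: fsvalP.
move=> H; suff /fintype.existsP[z /andP[/eqP/val_inj->]] :
  [exists z' : S, (val z' == val d) && hex_connect c z'] by [].
apply: H => [u v uS vS uv /fintype.existsP[z /andP[/eqP zE cz]]|].
  apply/fintype.existsP; exists [` vS]%fset; rewrite /= eqxx /=.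
  by apply: connect_trans cz (connect1 _); rewrite /= zE.
by apply/fintype.existsP; exists c; rewrite eqxx /hex_connect connect0.
Qed.

Lemma reach_refl (S : {fset cell}) c : c \in S -> reach S c c.
Proof. by []. Qed.

(** Adjacency is symmetric, so the complement of a closed predicate is closed as well. *)
Lemma reach_sym (S : {fset cell}) c d : reach S c d -> reach S d c.
Proof.
case=> cS dS H; split=> // A clA Ad; apply: contraT => Ac.
suff: ~~ A d by rewrite Ad.
apply: (H (fun z => ~~ A z)) Ac => u v uS vS uv; apply: contraNN => Av.
by apply: clA Av; rewrite // hex_adj_sym.
Qed.

Lemma reach_trans (S : {fset cell}) c d e : reach S c d -> reach S d e -> reach S c e.
Proof.
case=> cS _ cd [_ eS de]; split=> // A clA Ac.
by apply: (de A clA); apply: (cd A clA).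
Qed.

Lemma reach_adj (S : {fset cell}) c d : c \in S -> d \in S -> hex_adj c d -> reach S c d.
Proof. by move=> cS dS cd; split=> // A clA; apply: clA. Qed.

Lemma reach_sub (S S' : {fset cell}) c d : (S `<=` S')%fset -> reach S c d -> reach S' c d.
Proof.
move=> /fsubsetP SS' [cS dS H]; split; try exact: SS'.
by move=> A clA; apply: H => u v /SS' uS /SS' vS; apply: clA.
Qed.

Lemma hex_connectedP (S : {fset cell}) :
  hex_connected S <-> forall c d, c \in S -> d \in S -> reach S c d.
Proof.
split=> [H c d cS dS|H c d]; last by apply/hex_connectP; apply: H; exact: fsvalP.
by apply: (hex_connectP S [` cS]%fset [` dS]%fset).1.
Qed.

Lemma componentsP (S K : {fset cell}) : K \in components S <->
  exists2 c, c \in S & forall d, d \in K <-> reach S c d.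
Proof.
split=> [/imfsetP[/= c _ ->]|[c cS KE]].
  exists (val c); first exact: fsvalP.
  move=> d; split=> [/imfsetP[/= e ce ->]|cd]; first by apply/hex_connectP.
  have [_ dS _] := cd; apply/imfsetP; exists [` dS]%fset => //=.
  by apply/hex_connectP.
apply/imfsetP; exists [` cS]%fset => //=; apply/fsetP => d; apply/idP/imfsetP => /=.
  move=> /KE cd; have [_ dS _] := cd; exists [` dS]%fset => //=.
  by apply/hex_connectP.
by case=> e ce ->; apply/KE; apply/(hex_connectP S [` cS]%fset).
Qed.

Lemma component_of (S : {fset cell}) (c : cell) : c \in S ->
  exists2 K, K \in components S & forall e, e \in K <-> reach S c e.
Proof.
move=> cS; pose K := [fset e in S | `[< reach S c e >]]%fset.
have KE e : e \in K <-> reach S c e.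
  rewrite !inE; split=> [/andP[_ /asboolP]//|ce].
  by apply/andP; split; [case: ce|apply/asboolP].
by exists K => //; apply/componentsP; exists c.
Qed.

Definition in_column (S : {fset cell}) (x : int) := forall c, c \in S -> c.1 = x.

(** A missing cell of height t separates the stack: adjacency inside one stack changes the height by
    one, so within [S] the predicate of having height below t is closed. Conversely, one climbs cell
    by cell. *)
Lemma reach_columnP (S : {fset cell}) (x y z : int) : in_column S x ->
  reach S (x, y) (x, z) <->
  forall t : int, (y <= t <= z) || (z <= t <= y) -> (x, t) \in S.
Proof.
move=> Sx; have up (y' z' t : int) : reach S (x, y') (x, z') -> y' <= t <= z' -> (x, t) \in S.
  move=> [yS zS H] /andP[yt tz]; apply: contraT => tS.
  have : y' != t by apply: contraNneq tS => <-.
  have := H (fun c : cell => c.2 < t) _ => /= cl.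
  have /cl : forall u v : cell, u \in S -> v \in S -> hex_adj u v -> u.2 < t -> v.2 < t.
    move=> u v uS vS; rewrite hex_adjE (Sx u uS) (Sx v vS) => uv ut.
    have : v.2 != t.
      by apply: contraNneq tS => <-; rewrite -(Sx v vS) -surjective_pairing.
    lia.
  lia.
have down k (y' : int) : (forall t : int, y' <= t <= y' + k%:Z -> (x, t) \in S) ->
    reach S (x, y') (x, y' + k%:Z).
  elim: k => [|k IH] H; first by rewrite addr0; apply: reach_refl; apply: H; lia.
  apply: (reach_trans _ _ (x, y' + k%:Z)); first by apply: IH => t ?; apply: H; lia.
  by apply: reach_adj; rewrite ?hex_adjE /=; [apply: H| apply: H|]; lia.
split=> [yz t /orP[tI|tI]|H]; first exact: up yz tI.
  by apply: up tI; apply: reach_sym.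
have [le_yz|lt_zy] := leP y z.
  have -> : z = y + `|z - y|%N%:Z by lia.
  by apply: down => t ?; apply: H; lia.
apply: reach_sym; have -> : y = z + `|y - z|%N%:Z by lia.
by apply: down => t ?; apply: H; lia.
Qed.

Lemma in_columnE (S : {fset cell}) x c : in_column S x -> c \in S -> c = (x, c.2).
Proof. by move=> Sx /Sx <-; case: c. Qed.

(** * Vertical runs of cells *)

Definition run (x l : int) (a : nat) : {fset cell} :=
  [fset c in [seq (x, (l + i%:Z)%R) | i <- iota 0 a]]%fset.

Lemma in_run (x l : int) a c : (c \in run x l a) = (c.1 == x) && (l <= c.2 < l + a%:Z).
Proof.
rewrite inE; apply/mapP/andP => [[i + ->] /=|[/eqP <- lc]].
  by rewrite mem_iota eqxx; lia.
exists `|c.2 - l|%N; first by rewrite mem_iota; lia.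
by rewrite {1}[c]surjective_pairing; congr pair; lia.
Qed.

Lemma card_run x l a : #|` run x l a| = a.
Proof.
rewrite card_fseq undup_id ?size_map ?size_iota //.
by rewrite map_inj_uniq ?iota_uniq // => i j []; lia.
Qed.

(** A cell reachable from the run but outside it would force one of the two missing cells at the
    ends of the run to lie in [S]. *)
Lemma reach_run (S : {fset cell}) (x p : int) k (y : int) (d : cell) :
  in_column S x -> (run x p k `<=` S)%fset ->
  (x, p - 1) \notin S -> (x, p + k%:Z) \notin S -> p <= y < p + k%:Z ->
  reach S (x, y) d <-> d \in run x p k.
Proof.
case: d => [x' z] Sx /fsubsetP sub lowN highN yk; rewrite in_run /=; split=> [yd|].
  have [_ /Sx /= dx _] := yd; rewrite {}dx in yd *.
  move: yd => /(reach_columnP _ _ _ _ Sx) H; rewrite eqxx /=.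
  apply: contraT => out; have [dp|dp] := ltP z p.
    by move: lowN; rewrite H //; lia.
  by move: highN; rewrite H //; lia.
move=> /andP[/eqP -> dk].
by apply/(reach_columnP _ _ _ _ Sx) => t tk; apply: sub; rewrite in_run eqxx /=; lia.
Qed.

(** * Columns *)

Notation strip := (int * nat * nat)%type.

(* The cells of heights [l, l + a) and, above one missing cell,
   [l + a + 1, l + a + 1 + b) in the stack x. *)
Definition strip_cells (x : int) (d : strip) : {fset cell} :=
  let: (l, a, b) := d in (run x l a `|` run x (l + a%:Z + 1)%R b)%fset.

Definition strip_size (d : strip) : nat := (d.1.2 + d.2)%N.

(* Thanks to the gap having one cell only, the cells of stack x + 1 adjacent to
   strip_cells x d are consecutive: they have heights [d.1.1 - 1, strip_top d). *)
Definition strip_top (d : strip) : int :=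
  d.1.1 + d.1.2%:Z + (if d.2 is 0 then 0 else d.2.+1%:Z).

(* link d e: each component of strip_cells (x + 1) e shares an edge with
   strip_cells x d. *)
Definition link : rel strip := fun d e =>
  let: (l, a, b) := e in
  (0 < a)%N && (if b is 0 then (l < strip_top d) && (d.1.1 <= l + a%:Z)
                else d.1.1 <= l + a%:Z < strip_top d - 1).

Lemma in_strip_cells (x l : int) a b c : (c \in strip_cells x (l, a, b)) =
  (c.1 == x) && ((l <= c.2 < l + a%:Z) ||
                 (l + a%:Z + 1 <= c.2 < l + a%:Z + 1 + b%:Z)).
Proof. by rewrite in_fsetU !in_run -andb_orr. Qed.

Lemma in_column_strip x d : in_column (strip_cells x d) x.
Proof. by case: d => [[l a] b] c; rewrite in_strip_cells => /andP[/eqP]. Qed.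

Lemma card_strip_cells x d : #|` strip_cells x d| = strip_size d.
Proof.
case: d => [[l a] b]; rewrite /strip_cells cardfsU !card_run /strip_size /=.
have -> : (run x l a `&` run x (l + a%:Z + 1) b)%fset = fset0.
  by apply/fsetP => -[u v]; rewrite in_fsetI !in_run in_fset0 /=; lia.
by rewrite cardfs0 subn0.
Qed.

Lemma strip_cells_neq0 x l a b : (0 < a)%N -> strip_cells x (l, a, b) != fset0.
Proof.
move=> a0; apply/fset0Pn; exists (x, l).
by rewrite in_strip_cells eqxx /=; lia.
Qed.

(** The heights give back the code: [l] is the lowest one, [l + a] the first missing one, and the
    end of the upper run then yields [b]. Positivity matters: [(l, 0, b)] and [(l + 1, b, 0)] have
    the same cells. *)
Lemma strip_cells_inj x d e : (0 < d.1.2)%N -> (0 < e.1.2)%N ->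
  strip_cells x d = strip_cells x e -> d = e.
Proof.
case: d e => [[l a] b] [[l' a'] b'] /= a0 a'0 eqS.
have mem (y : int) : ((l <= y < l + a%:Z) || (l + a%:Z + 1 <= y < l + a%:Z + 1 + b%:Z)) =
    ((l' <= y < l' + a'%:Z) || (l' + a'%:Z + 1 <= y < l' + a'%:Z + 1 + b'%:Z)).
  have /fsetP/(_ (x, y)) := eqS.
  by rewrite -!/(strip_cells x (_, _, _)) !in_strip_cells eqxx.
have ll : l = l' by move: (mem l) (mem l'); lia.
subst l'; have aa : a = a' by move: (mem (l + a%:Z)) (mem (l + a'%:Z)); lia.
subst a'; have -> : b = b'; last by [].
by move: (mem (l + a%:Z + 1 + b%:Z)) (mem (l + a%:Z + 1 + b'%:Z)); lia.
Qed.

(** The missing cell of height [l + a] separates the two runs, so [reach_run] applies to each of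
    them. *)
Lemma components_strip x l a b K : (0 < a)%N ->
  K \in components (strip_cells x (l, a, b)) <->
  K = run x l a \/ (0 < b)%N /\ K = run x (l + a%:Z + 1) b.
Proof.
move=> a0; set S := strip_cells _ _.
have Sx : in_column S x := in_column_strip x (l, a, b).
have lowC (y : int) d : l <= y < l + a%:Z -> reach S (x, y) d <-> d \in run x l a.
  apply: reach_run => //; rewrite ?in_strip_cells ?eqxx /=; try lia.
  exact: fsubsetUl.
have highC (y : int) d : l + a%:Z + 1 <= y < l + a%:Z + 1 + b%:Z ->
    reach S (x, y) d <-> d \in run x (l + a%:Z + 1) b.
  apply: reach_run => //; rewrite ?in_strip_cells ?eqxx /=; try lia.
  exact: fsubsetUr.
split=> [/componentsP[c cS KE]|].
  have cE := in_columnE _ _ _ Sx cS.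
  move: cS; rewrite in_strip_cells => /andP[_ /orP[low|high]]; [left|right].
    by apply/fsetP => d; apply/idP/idP => [/KE|/lowC cd]; [rewrite cE => /lowC; apply|
       apply/KE; rewrite cE; exact: cd].
  split; first by lia.
  by apply/fsetP => d; apply/idP/idP => [/KE|/highC cd]; [rewrite cE => /highC; apply|
       apply/KE; rewrite cE; exact: cd].
case=> [->|[b0 ->]]; apply/componentsP.
  exists (x, l); first by rewrite in_strip_cells eqxx /=; lia.
  by move=> d; apply: iff_sym; apply: lowC; lia.
exists (x, l + a%:Z + 1); first by rewrite in_strip_cells eqxx /=; lia.
by move=> d; apply: iff_sym; apply: highC; lia.
Qed.

Lemma strip_connected x l a b : (0 < a)%N ->
  hex_connected (strip_cells x (l, a, b)) <-> b = 0%N.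
Proof.
move=> a0; have Sx := in_column_strip x (l, a, b); split.
  move/hex_connectedP => H; case: b Sx H => // b Sx H.
  have /(reach_columnP _ _ _ _ Sx)/(_ (l + a%:Z)) :
      reach (strip_cells x (l, a, b.+1)) (x, l) (x, l + a%:Z + 1).
    by apply: H; rewrite in_strip_cells eqxx /=; lia.
  by rewrite in_strip_cells eqxx /=; lia.
move=> b0; apply/hex_connectedP => -[x1 y] [x2 z] cS dS.
have [/= x1E x2E] := (Sx _ cS, Sx _ dS); rewrite {}x1E in cS *; rewrite {}x2E in dS *.
apply/(reach_columnP _ _ _ _ Sx) => t.
by move: cS dS; rewrite b0 !in_strip_cells eqxx /=; lia.
Qed.

(** The cell of height t in stack [x + 1] touches those of heights t and t + 1 in stack [x]. So the
    run has to meet the interval from [d.1.1 - 1] to [strip_top d], upper end excluded. *)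
Lemma share_edge_strip (x p : int) k d : (0 < k)%N -> (0 < d.1.2)%N ->
  share_edge (run (x + 1) p k) (strip_cells x d) <->
  (p < strip_top d) && (d.1.1 <= p + k%:Z).
Proof.
case: d => [[l a] b] k0 /= a0; split.
  case=> -[x1 y] [[x2 z] []]; rewrite in_run in_strip_cells hex_adjE /strip_top /=.
  by case: b => [|b]; lia.
move=> H; have [t [tk tl]] : exists t : int, p <= t < p + k%:Z /\ l - 1 <= t < strip_top (l, a, b).
  have [pl|lp] := leP p (l - 1).
    by exists (l - 1); move: H; rewrite /strip_top /=; case: (b) => [|?]; lia.
  by exists p; lia.
suff [s sS st] : exists2 s : int, (x, s) \in strip_cells x (l, a, b) & (s == t) || (s == t + 1).
  exists (x + 1, t), (x, s); split=> //; first by rewrite in_run eqxx /=; lia.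
  by rewrite hex_adjE /=; lia.
(* One of the heights [t] and [t + 1] is occupied because the gap has a single cell. *)
have /orP[in_t|in_t1] : ((x, t) \in strip_cells x (l, a, b)) ||
    ((x, t + 1) \in strip_cells x (l, a, b)).
- rewrite !in_strip_cells eqxx /=; move: tl; rewrite /strip_top /=.
  by case: (b) => [|?]; lia.
- by exists t; rewrite ?eqxx.
- by exists (t + 1); rewrite ?eqxx ?orbT.
Qed.

(** With two components, [share_edge_strip] gives four inequalities. The lower run has to extend up
    to the interval of adjacent cells and the upper run has to start below its end; these two imply
    the others. *)
Lemma link_share_edge (x : int) d e : (0 < d.1.2)%N -> (0 < e.1.2)%N ->
  link d e <->
  forall K, K \in components (strip_cells (x + 1) e) -> share_edge K (strip_cells x d).
Proof.
case: e => [[l a] b] d0 /= a0; split.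
  move=> lk K /(components_strip _ _ _ _ _ a0) [->|[b0 ->]]; apply/share_edge_strip => //.
    by move: lk; rewrite /link a0 /=; case: (b) => [|?]; lia.
  by move: lk b0; rewrite /link a0 /=; case: (b) => [|?]; lia.
move=> H; rewrite /link a0 /=.
have /share_edge_strip : share_edge (run (x + 1) l a) (strip_cells x d).
  by apply: H; apply/components_strip => //; left.
move=> /(_ a0 d0); case: b H => [|b] H // H1.
have /share_edge_strip : share_edge (run (x + 1) (l + a%:Z + 1) b.+1) (strip_cells x d).
  by apply: H; apply/components_strip => //; right.
by move=> /(_ isT d0); lia.
Qed.

Lemma card_fset_le2 (T : choiceType) (A : {fset T}) (a b : T) :
  (forall c, c \in A -> c = a \/ c = b) -> (#|` A| <= 2)%N.
Proof.
move=> H; apply: leq_trans (_ : #|` [fset a; b]%fset| <= 2)%N; last by rewrite cardfs2; case: eqP.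
by apply: fsubset_leq_card; apply/fsubsetP => c /H [] ->; rewrite !inE eqxx ?orbT.
Qed.

Lemma card_components_strip x d : (0 < d.1.2)%N ->
  (#|` components (strip_cells x d)| <= 2)%N.
Proof.
case: d => [[l a] b] /= a0; apply: card_fset_le2 => K.
by move=> /(components_strip _ _ _ _ _ a0) [|[_]] KE; [left|right]; exact: KE.
Qed.

(** If [K] is the lower run, the only candidate is the missing cell of height [l + a]; if [K] is the
    upper run, no cell is above [K] and below [L]. *)
Lemma gap_strip x d K L : (0 < d.1.2)%N ->
  K \in components (strip_cells x d) -> L \in components (strip_cells x d) ->
  K != L -> (gap x K L #<= `I_1)%card.
Proof.
case: d => [[l a] b] /= a0 KC LC KL.
have sub1 c : (gap x K L `<=` [set c])%classic -> (gap x K L #<= `I_1)%card.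
  by move=> /subset_card_le h; rewrite (card_le_eqr card_set1) in h.
move: KC LC KL => /(components_strip _ _ _ _ _ a0) KE /(components_strip _ _ _ _ _ a0) LE KL.
apply: (sub1 (x, l + a%:Z)) => -[u v] [/= -> Kv Lv].
case: KE LE KL Kv Lv => [->|[b0 ->]] [->|[b0' ->]]; rewrite ?eqxx // => _ Kv Lv.
  have /= vK : (x, l + a%:Z - 1).2 < v by apply: Kv; rewrite in_run eqxx /=; lia.
  have /= vL : v < (x, l + a%:Z + 1).2 by apply: Lv; rewrite in_run eqxx /=; lia.
  by congr pair; lia.
have /= vK : (x, l + a%:Z + 1).2 < v by apply: Kv; rewrite in_run eqxx /=; lia.
have /= vL : v < (x, l).2 by apply: Lv; rewrite in_run eqxx /=; lia.
by lia.
Qed.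

Lemma gap_le1_eq x K L (c e : cell) : (gap x K L #<= `I_1)%card ->
  gap x K L c -> gap x K L e -> c = e.
Proof.
move=> le1 cg eg; apply: contrapT => /eqP ce.
have : ([set` [fset c; e]%fset] `<=` gap x K L)%classic.
  by move=> u /=; rewrite !inE => /orP[] /eqP ->.
move=> /subset_card_le/card_le_trans/(_ le1).
have /card_eq_fsetP/card_le_eql -> : #|` [fset c; e]%fset| = 2 by rewrite cardfs2 ce.
by rewrite card_le_II.
Qed.

(** * Recognizing a column as a strip *)

Lemma int_fset_bound (S : {fset cell}) : exists N : nat,
  forall c, c \in S -> `|c.1| < N%:Z /\ `|c.2| < N%:Z.
Proof.
pose F (c : S) := maxn `|(val c).1|%N.+1 `|(val c).2|%N.+1.
exists (\max_c F c) => -[u v] cS.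
have : (F [` cS]%fset <= \max_c F c)%N by exact: leq_bigmax.
by move: (\max_c F c) => N; rewrite /F /=; lia.
Qed.

Lemma fset_run_end (S : {fset cell}) (x y : int) : (x, y) \in S ->
  exists2 k : nat, (0 < k)%N /\ (x, y + k%:Z) \notin S &
    forall t : int, y <= t < y + k%:Z -> (x, t) \in S.
Proof.
move=> yS; have ex : exists k : nat, (x, y + k%:Z) \notin S.
  have [N bd] := int_fset_bound S; exists (`|y| + N)%N.
  by apply/negP => /bd /= []; lia.
case: (ex_minnP ex) => k kS kmin; exists k => [|t tk].
  by split=> //; case: k kS {kmin} => //; rewrite addr0 yS.
apply: contraT => tS; have := kmin `|t - y|%N.
by rewrite (_ : y + `|t - y|%N%:Z = t) => [/(_ tS)|]; lia.
Qed.

Lemma fset_minP (S : {fset cell}) (h : cell -> int) : S != fset0 ->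
  exists2 c : cell, c \in S & forall e : cell, e \in S -> h c <= h e.
Proof.
move=> /fset0Pn[c0 c0S].
case: (@arg_minP _ _ S [` c0S]%fset predT (fun c => h (val c)) isT) => c _ cmin.
exists (val c); first exact: fsvalP.
by move=> e eS; apply: (cmin [` eS]%fset).
Qed.

(** The lowest cell starts a first run. If cells remain, the lowest of them starts a second run, in
    another component. The gap bound leaves one missing cell between the runs, and the bound on
    components leaves room for nothing else. *)
Lemma column_strip (S : {fset cell}) (x : int) : S != fset0 -> in_column S x ->
  (#|` components S| <= 2)%N ->
  (forall K L, K \in components S -> L \in components S -> K != L ->
     (gap x K L #<= `I_1)%card) ->
  exists2 d, (0 < d.1.2)%N & S = strip_cells x d.
Proof.
move=> S0 Sx cS gS.
have [[x' l] lS lmin] := fset_minP S snd S0.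
have /= := Sx _ lS; move=> xE; rewrite {}xE in lS lmin.
have [a [a0 aS] aI] := fset_run_end S x l lS.
have lowK e : reach S (x, l) e <-> e \in run x l a.
  apply: reach_run => //; [|by apply/negP => /lmin /=; lia|by lia].
  by apply/fsubsetP => -[u v]; rewrite in_run /= => /andP[/eqP -> /aI].
have [SE|/eqP] := eqVneq S (run x l a).
  by exists (l, a, 0%N) => //; apply/fsetP => -[u v]; rewrite in_strip_cells SE in_run /=; lia.
pose U := [fset c in S | (l + a%:Z < c.2)%R]%fset.
have splitS c : c \in S -> (c \in run x l a) || (c \in U).
  case: c => u v cS'; have /= uE := Sx _ cS'; have /= := lmin _ cS'.
  rewrite in_run !inE cS' uE eqxx /= => lv.
  have : v != l + a%:Z by apply: contraNneq aS => <-; rewrite -uE.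
  lia.
have runS c : c \in run x l a -> c \in S.
  by case: c => u v; rewrite in_run /= => /andP[/eqP -> /aI].
move=> neq; have U0 : U != fset0.
  apply/eqP => U0; apply: neq; apply/fsetP => c; apply/idP/idP => [cS'|/runS//].
  by have := splitS c cS'; rewrite U0 in_fset0 orbF.
have [[x1 z] + zmin] := fset_minP U snd U0; rewrite !inE /= => /andP[zS z_gt].
have /= := Sx _ zS; move=> xE; rewrite {}xE in zS zmin.
have [K KC KE] := component_of _ _ lS; have [L LC LE] := component_of _ _ zS.
have KL : K != L.
  apply/eqP => KL; have /KE/lowK : (x, z) \in K by rewrite KL; apply/LE/reach_refl.
  by rewrite in_run eqxx /=; lia.
have L_ge c : c \in L -> z <= c.2.
  case: c => u v cL; have /LE [_ cS' _] := cL; have /orP[cl|] := splitS _ cS'; last exact: zmin.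
  suff : (x, z) \in run x l a by rewrite in_run eqxx /=; lia.
  by apply/lowK; apply: (reach_trans _ _ (u, v)); [apply/lowK|apply: reach_sym; apply/LE].
(* If the second run began higher, the cells of heights [l + a] and [l + a + 1] would both be in the
   gap. *)
have zE : z = l + a%:Z + 1.
  have gapP (t : int) : l + a%:Z <= t < z -> gap x K L (x, t).
    move=> tI; split=> //= -[u v] => [/KE/lowK|/L_ge /=]; last by lia.
    by rewrite in_run /=; lia.
  have zU : l + a%:Z < z by [].
  apply: contrapT => zN.
  have g1 : gap x K L (x, l + a%:Z) by apply: gapP; lia.
  have g2 : gap x K L (x, l + a%:Z + 1) by apply: gapP; lia.
  by have [] := gap_le1_eq _ _ _ _ _ (gS K L KC LC KL) g1 g2; lia.
have [b [b0 bS] bI] := fset_run_end S x z zS.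
(* The component of a cell outside [K] and [L] would be a third one. *)
have other c : c \in S -> c \in K \/ c \in L.
  move=> cS'; have [M MC ME] := component_of _ _ cS'; have cM : c \in M by apply/ME/reach_refl.
  have [MK|/eqP MK] := eqVneq M K; first by left; rewrite -MK.
  have [ML|/eqP ML] := eqVneq M L; first by right; rewrite -ML.
  exfalso; have : (#|` (M |` [fset K; L])%fset| <= 2)%N.
    apply: leq_trans cS; apply: fsubset_leq_card; apply/fsubsetP => N.
    by rewrite !inE => /orP[|/orP[]] /eqP ->.
  by rewrite cardfsU1 cardfs2 !inE; move: MK ML KL => /eqP/negPf -> /eqP/negPf -> ->.
exists (l, a, b) => //; apply/fsetP => -[u v]; rewrite in_strip_cells /=.
apply/idP/andP => [cS'|[/eqP -> /orP[/aI//|H]]]; last by apply: bI; rewrite zE.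
have /= uE := Sx _ cS'; split; first by rewrite uE.
have [/KE/lowK|vL] := other _ cS'; first by rewrite in_run /= => /andP[_ ->].
have := L_ge _ vL => /= zv; apply/orP; right.
have /LE := vL; rewrite uE => /(reach_columnP _ _ _ _ Sx) H.
suff : ~ (z + b%:Z <= v) by lia.
by move=> bv; move: bS; rewrite H //; lia.
Qed.

(** * Cheesy polyominoes as sequences of columns *)

(** Strips are put in successive stacks without recording positions: semi-directedness excludes
    empty stacks between columns. *)
Fixpoint decode (x : int) (s : seq strip) : {fset cell} :=
  if s is d :: s' then (strip_cells x d `|` decode (x + 1)%R s')%fset else fset0.

Definition all_positive (s : seq strip) := all (fun d => 0 < d.1.2)%N s.

Lemma path_link_positive d s : path link d s -> all_positive s.
Proof.
elim: s d => //= -[[l a] b] s IH d /andP[lk /IH ->].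
by move: lk; rewrite /link => /andP[->].
Qed.

Lemma in_column_column P x : in_column (column P x) x.
Proof. by move=> c; rewrite !inE => /andP[_ /eqP]. Qed.

Lemma in_column_of (P : {fset cell}) (x : int) (c : cell) :
  (c \in column P x) = (c \in P) && (c.1 == x).
Proof. by rewrite !inE. Qed.

Lemma in_decode_cons x d s c :
  (c \in decode x (d :: s)) = (c \in strip_cells x d) || (c \in decode (x + 1) s).
Proof. by rewrite inE. Qed.

Lemma decode_ge (x : int) s (c : cell) : c \in decode x s -> x <= c.1.
Proof.
elim: s x => [|d s IH] x; first by rewrite inE.
rewrite in_decode_cons => /orP[/in_column_strip ->//|/IH {IH}]; case: c => u v /=; lia.
Qed.

Lemma column_decode_head x d s : column (decode x (d :: s)) x = strip_cells x d.
Proof.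
apply/fsetP => -[u v]; rewrite in_column_of in_decode_cons /=; apply/andP/idP.
  by case=> /orP[//|/decode_ge /=]; lia.
by move=> cd; rewrite cd; have /= -> := in_column_strip _ _ _ cd.
Qed.

Lemma column_decode_behead (x y : int) d s : x < y ->
  column (decode x (d :: s)) y = column (decode (x + 1) s) y.
Proof.
move=> xy; apply/fsetP => -[u v]; rewrite !in_column_of in_decode_cons /=.
case: (boolP (_ \in strip_cells x d)) => //= /in_column_strip /= ->.
have -> : (x == y) = false by lia.
by rewrite andbF.
Qed.

Lemma column_decode_nth x s i d0 : (i < size s)%N ->
  column (decode x s) (x + i%:Z) = strip_cells (x + i%:Z) (nth d0 s i).
Proof.
elim: s x i => // d s IH x [|i] lt_i; first by rewrite addr0 column_decode_head.
rewrite column_decode_behead; last by lia.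
by rewrite (_ : x + i.+1%:Z = x + 1 + i%:Z) ?IH //; lia.
Qed.

Lemma decode_lt (x : int) s (c : cell) : c \in decode x s -> c.1 < x + (size s)%:Z.
Proof.
elim: s x => [|d s IH] x; first by rewrite inE.
rewrite in_decode_cons => /orP[/in_column_strip ->//|/IH {IH}]; first by rewrite /=; lia.
case: c => u v /=; lia.
Qed.

Lemma has_column_decodeP (x y : int) s : all_positive s ->
  has_column (decode x s) y <-> exists2 i : nat, (i < size s)%N & y = x + i%:Z.
Proof.
move=> pos; split=> [/fset0Pn[[u v]]|[i lt_i ->]].
  rewrite in_column_of /= => /andP[cs /eqP <-].
  have /= := decode_lt _ _ _ cs; have /= := decode_ge _ _ _ cs.
  by exists `|u - x|%N; lia.
rewrite /has_column (column_decode_nth _ _ _ (0, 0%N, 0%N)) //.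
have := all_nthP (0, 0%N, 0%N) pos i lt_i.
by case: (nth _ _ _) => -[l a] b; exact: strip_cells_neq0.
Qed.

Lemma card_decode x s : #|` decode x s| = sumn (map strip_size s).
Proof.
elim: s x => [|d s IH] x; first by [].
rewrite [LHS](cardfsU (strip_cells x d)) card_strip_cells IH.
have -> : (strip_cells x d `&` decode (x + 1) s)%fset = fset0.
  apply/fsetP => -[u v]; rewrite in_fsetI in_fset0.
  by apply/negP => /andP[/in_column_strip /= -> /decode_ge /=]; lia.
by rewrite cardfs0 subn0.
Qed.

(** The stack [x] determines the first strip, and the stacks to its right determine the others. *)
Lemma decode_inj x s s' : all_positive s -> all_positive s' ->
  decode x s = decode x s' -> s = s'.
Proof.
have neq0 y d t : all_positive (d :: t) -> decode y (d :: t) != fset0.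
  case: d => [[l a] b] /andP[/= a0 _]; apply/fset0Pn; exists (y, l).
  by rewrite in_fsetU in_strip_cells eqxx /=; lia.
elim: s s' x => [|d s IH] [|d' s'] x // ps ps' E.
- by have := neq0 x _ _ ps'; rewrite -E eqxx.
- by have := neq0 x _ _ ps; rewrite E eqxx.
have [/andP[d0 ps1] /andP[d'0 ps'1]] := (ps, ps').
have dd' : d = d'.
  apply: (strip_cells_inj x) => //.
  by rewrite -(column_decode_head x d s) E column_decode_head.
congr cons => //; apply: (IH _ (x + 1)) => //; apply/fsetP => -[u v].
have /fsetP/(_ (u, v)) := E; rewrite !in_decode_cons dd'.
have [/in_column_strip /= ->|//] := boolP ((u, v) \in strip_cells x d').
have out t : (x, v) \in decode (x + 1) t = false.
  by apply/negP => /decode_ge /=; lia.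
by rewrite !out.
Qed.

(** * Translations *)

Definition shift (w : int) (d : strip) : strip := (d.1.1 + w, d.1.2, d.2).

Lemma in_translate v P c : (c \in translate v P) = (c - v \in P).
Proof.
apply/imfsetP/idP => [[e /= eP ->]|cP]; first by rewrite addrK.
by exists (c - v) => //=; rewrite subrK.
Qed.

Lemma translate_decode (v : cell) x s :
  translate v (decode x s) = decode (x + v.1) (map (shift v.2) s).
Proof.
case: v => v w; elim: s x => [|d s IH] x /=.
  by apply/fsetP => c; rewrite in_translate !in_fset0.
apply/fsetP => -[y z]; rewrite in_translate !in_fsetU -(in_translate _ (decode _ _)) IH /=.
rewrite (_ : x + 1 + v = x + v + 1); last by lia.
congr (_ || _); case: d => [[l a] b]; rewrite /shift !in_strip_cells /= ?in_fsetU ?in_run /=; lia.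
Qed.

Lemma translate_class_eq P Q : translation_class P = translation_class Q <->
  exists v, P = translate v Q.
Proof.
have t0 R : translate 0 R = R by apply/fsetP => c; rewrite in_translate subr0.
have tD u v R : translate u (translate v R) = translate (v + u) R.
  by apply/fsetP => c; rewrite !in_translate opprD addrA addrAC.
split=> [E|[v ->]].
  have : translation_class P P by exists 0; rewrite ?t0.
  by rewrite E => -[v _ vE]; exists v.
apply/seteqP; split=> _ [u _ <-]; first by exists (v + u); rewrite ?tD.
by exists (u - v); rewrite ?tD // addrC subrK.
Qed.

(** Reachability spreads from each column to the next: every component shares an edge with the
    column on its left, and its cells are all reachable from the one on that edge. *)
Lemma reach_decode s d x (S : {fset cell}) o : (0 < d.1.2)%N -> path link d s ->
  (decode x (d :: s) `<=` S)%fset -> {in strip_cells x d, forall c, reach S o c} ->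
  {in decode x (d :: s), forall c, reach S o c}.
Proof.
elim: s d x => [|e s IH] d x d0 /= => [_ _ H c|/andP[de es] sub H c].
  by rewrite in_fsetU in_fset0 orbF => /H.
have e0 : (0 < e.1.2)%N by case: e de {es sub} => -[l a] b; rewrite /link => /andP[].
rewrite in_fsetU => /orP[/H//|]; move: c; apply: IH => //.
  by apply: fsubset_trans sub; rewrite fsubsetUr.
move=> c cE; have [K KC KE] := component_of _ _ cE.
have [k [l [kK lD kl]]] := (link_share_edge x d e d0 e0).1 de K KC.
have subE : (strip_cells (x + 1) e `<=` S)%fset.
  by apply: fsubset_trans sub; apply: fsubset_trans (fsubsetUr _ _); exact: fsubsetUl.
have /(reach_sub _ _ _ _ subE) ck := (KE k).1 kK.
have [_ kS _] := ck; have ol := H _ lD; have [_ lS _] := ol.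
apply: (reach_trans _ _ l) => //; apply: (reach_trans _ _ k); last exact: reach_sym.
by apply: reach_adj; rewrite // hex_adj_sym.
Qed.

Lemma cheesy_decode x l a s : (0 < a)%N -> path link (l, a, 0%N) s ->
  cheesy 1 (decode x ((l, a, 0%N) :: s)).
Proof.
set d := (l, a, 0%N) => a0 ps; set P := decode x (d :: s).
have pos : all_positive (d :: s) by rewrite /= a0 (path_link_positive _ _ ps).
have colE y : has_column P y -> exists2 e, (0 < e.1.2)%N & column P y = strip_cells y e.
  move=> /(has_column_decodeP _ _ _ pos)[i lt_i ->].
  exists (nth d (d :: s) i); last exact: column_decode_nth.
  exact: (all_nthP d pos).
have colE' y K : K \in components (column P y) -> has_column P y.
  by move=> /componentsP[c cP _]; apply/fset0Pn; exists c.
have o_in : (x, l) \in P by rewrite in_fsetU in_strip_cells eqxx /=; lia.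
split.
- split; first by apply/fset0Pn; exists (x, l).
  apply/hex_connectedP => c e cP eP.
  have oP : {in P, forall c, reach P (x, l) c}.
    apply: reach_decode => // c' c'D.
    have /hex_connectedP conn : hex_connected (strip_cells x d) by apply/strip_connected.
    apply: reach_sub (conn _ _ _ c'D); first exact: fsubsetUl.
    by rewrite in_strip_cells eqxx /=; lia.
  by apply: (reach_trans _ _ (x, l)); [apply: reach_sym|]; exact: oP.
- split=> [y [/(has_column_decodeP _ _ _ pos)[i lt_i ->] ymin]|].
    have /ymin xi : has_column P x by rewrite /has_column column_decode_head strip_cells_neq0.
    have -> : i = 0%N by lia.
    by rewrite addr0 column_decode_head; apply/strip_connected.
  move=> y y' [/(has_column_decodeP _ _ _ pos)[i lt_i ->]
    /(has_column_decodeP _ _ _ pos)[j lt_j ->] ij btw].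
  (* Otherwise the strip of index [i.+1] would be a column strictly between the two. *)
  have jE : j = i.+1.
    apply: contrapT => jN; have /btw : has_column P (x + i.+1%:Z).
      by apply/has_column_decodeP => //; exists i.+1 => //; lia.
    by lia.
  rewrite {}jE in lt_j btw *; rewrite !(column_decode_nth _ _ _ d) //.
  rewrite (_ : x + i.+1%:Z = x + i%:Z + 1); last by lia.
  apply/link_share_edge; try exact: (all_nthP d pos).
  exact: (pathP d ps i).
- move=> y; have [E|] := eqVneq (column P y) fset0.
    rewrite E; apply: (@leq_trans 0) => //; rewrite leqn0 cardfs_eq0; apply/eqP/fsetP => K.
    by rewrite in_fset0; apply/negP => /componentsP[c]; rewrite in_fset0.
  by move=> /colE[e e0 ->]; exact: card_components_strip.
move=> y K L KC; have [e e0 E] := colE _ (colE' _ _ KC).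
by rewrite E in KC *; exact: gap_strip.
Qed.

(** The columns are read from left to right: each is a strip by [column_strip], and
    semi-directedness links it to the preceding one. *)
Lemma cheesy_decodable P : cheesy 1 P -> exists x l a s,
  [/\ (0 < a)%N, path link (l, a, 0%N) s & P = decode x ((l, a, 0%N) :: s)].
Proof.
move=> [[P0 _] [first_conn adj_share] card2 gap1].
have [[x0 y0] o_in x0min] := fset_minP P fst P0.
have hasP (c : cell) : c \in P -> has_column P c.1.
  by move=> cP; apply/fset0Pn; exists c; rewrite in_column_of cP eqxx.
have colP x : has_column P x -> exists2 d, (0 < d.1.2)%N & column P x = strip_cells x d.
  by move=> hx; apply: column_strip (gap1 x) => //; exact: in_column_column.
(* A column other than the leftmost shares an edge with the nearest column on its left, and edges
   join only neighbouring stacks. *)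
have prev (x : int) : x0 < x -> has_column P x -> adjacent_columns P (x - 1) x.
  move=> x0x hx; pose U := [fset c in P | (c.1 < x)%R]%fset.
  have U0 : U != fset0 by apply/fset0Pn; exists (x0, y0); rewrite !inE /= o_in.
  have [[y z] + ymax] := fset_minP U (fun c => - c.1) U0.
  rewrite !inE /= => /andP[cP yx].
  have adj : adjacent_columns P y x.
    split=> //; first exact: (hasP _ cP).
    move=> t /fset0Pn[[t' w]]; rewrite in_column_of /= => /andP[tP /eqP tt].
    rewrite {}tt in tP; apply/negP => tI; have := ymax (t, w).
    by rewrite !inE tP /= => H; have := H _; lia.
  have /fset0Pn[c cx] := hx; have [K KC _] := component_of _ _ cx.
  have [[k1 k2] [[l1 l2] [kK]]] := adj_share _ _ adj K KC.
  rewrite in_column_of hex_adjE /= => /andP[_ /eqP l1E] kl.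
  have k1E : k1 = x.
    have /componentsP[c' _ KE] := KC; have [_ kx _] := (KE _).1 kK.
    by move: kx; rewrite in_column_of => /andP[_ /eqP].
  by rewrite (_ : x - 1 = y) //; lia.
have down (x : int) j : x0 <= x -> has_column P (x + j%:Z) -> has_column P x.
  elim: j => [|j IH] x0x; first by rewrite addr0.
  move=> h; have [|+ _ _ _] := prev _ _ h; first by lia.
  by rewrite (_ : x + j.+1%:Z - 1 = x + j%:Z); [exact: IH|lia].
(* [N] bounds the number of stacks left to read. If the stack [x + 1] is empty, [down] shows that
   nothing of [P] lies further right. *)
have chain N (x : int) : x0 <= x -> has_column P x -> (forall c, c \in P -> c.1 < x + N%:Z) ->
    exists d s, [/\ (0 < d.1.2)%N, path link d s, column P x = strip_cells x d &
      forall c, (c \in decode x (d :: s)) = (c \in P) && (x <= c.1)].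
  elim: N x => [|N IH] x x0x hx bd.
    have /fset0Pn[[u v]] := hx; rewrite in_column_of => /andP[/bd /= + /eqP /=]; lia.
  have [d d0 dE] := colP _ hx.
  have strE c : (c \in strip_cells x d) = (c \in P) && (c.1 == x) by rewrite -dE in_column_of.
  have [hx1|nhx1] := pselect (has_column P (x + 1)); last first.
    exists d, [::]; split=> // -[u v]; rewrite in_decode_cons in_fset0 orbF strE /=.
    have [uvP /=|//] := boolP (_ \in P); apply/eqP/idP => [->//|xu].
    apply: contrapT => ux; apply: nhx1.
    apply: (down (x + 1) `|(u - (x + 1))%R|%N); first by lia.
    by rewrite (_ : x + 1 + _ = u); [exact: (hasP _ uvP)|lia].
  have bd1 (c : cell) : c \in P -> c.1 < x + 1 + N%:Z.
    by case: c => u v /bd /=; lia.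
  have [|e [s [e0 es eE tE]]] := IH (x + 1) _ hx1 bd1; first by lia.
  exists d, (e :: s); split=> // [|[u v]].
    rewrite /= es andbT; apply/(link_share_edge x d e d0 e0); rewrite -eE -dE.
    apply: adj_share; rewrite -[X in adjacent_columns P X _](addrK 1).
    by apply: prev => //; lia.
  rewrite in_decode_cons strE tE /=.
  by case: (_ \in P) => //=; lia.
have [N bd] := int_fset_bound P.
have hx0 : has_column P x0 := hasP _ o_in.
have [|[[l a] b] [s [a0 ps dE tE]]] := chain (N + `|x0|)%N x0 (lexx x0) hx0.
  by move=> -[u v] /bd /= [+ _]; lia.
have b0 : b = 0%N.
  apply/(strip_connected x0 l a b a0); rewrite -dE; apply: first_conn; split=> // y.
  by move=> /fset0Pn[c]; rewrite in_column_of => /andP[cP /eqP <-]; exact: x0min.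
rewrite {}b0 in ps tE; exists x0, l, a, s; split=> //.
by apply/fsetP => c; rewrite tE andb_idr // => /x0min.
Qed.

(** * Counting *)

(** Here [s0], [s1], [s2] are meant to be the sums of k^i q^k over k > 0, and [a], [b] the series of
    intercepts and slopes of the counts as functions of l. Comparing the coefficients of l in the
    recurrence gives the equations for [b] and [a]; that for [c] comes from a connected first
    column. Powers of [1 - q] clear the denominators. *)
Lemma linear_system_solution (R : comUnitRingType) (q s0 s1 s2 a b c : R) :
  1 - q \is a GRing.unit ->
  (1 - q) * s0 = q -> (1 - q) * s1 = s0 -> (1 - q) * s2 = 2 * s1 - s0 ->
  b = s1 * a + (s2 + 2 * s1 - s0) * b ->
  a = 1 - (s1 - s0) * a - (s2 + 2 * s1 - 3 * s0) * b ->
  c = s0 * a + (s1 + s0) * b ->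
  (1 - 6 * q + 8 * q ^+ 2 - q ^+ 3) * c = q * (1 - 3 * q + q ^+ 2).
Proof.
move=> uU e0 e1 e2 eb ea ec; set u := 1 - q in uU e0 e1 e2.
have f1 : u ^+ 2 * s1 = q by rewrite -e0 -e1; ring.
have f2 : u ^+ 3 * s2 = q * (1 + q).
  have -> : u ^+ 3 * s2 = u ^+ 2 * (u * s2) by ring.
  rewrite e2 mulrBr mulrCA f1.
  have -> : u ^+ 2 * s0 = u * (u * s0) by ring.
  by rewrite e0 /u; ring.
have g1 : u ^+ 3 * b = q * u * a + (2 * q + q ^+ 2 - q ^+ 3) * b.
  rewrite [in LHS]eb.
  transitivity (u * (u ^+ 2 * s1) * a +
    (u ^+ 3 * s2 + 2 * u * (u ^+ 2 * s1) - u ^+ 2 * (u * s0)) * b); first by ring.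
  by rewrite f1 f2 e0 /u; ring.
have g2 : u ^+ 3 * a = u ^+ 3 - q ^+ 2 * u * a - (5 * q ^+ 2 - 3 * q ^+ 3) * b.
  rewrite [in LHS]ea.
  transitivity (u ^+ 3 - (u * (u ^+ 2 * s1) - u ^+ 2 * (u * s0)) * a -
    (u ^+ 3 * s2 + 2 * u * (u ^+ 2 * s1) - 3 * u ^+ 2 * (u * s0)) * b); first by ring.
  by rewrite f1 f2 e0 /u; ring.
have g3 : u ^+ 3 * c = q * u ^+ 2 * a + (q * u + q * u ^+ 2) * b.
  rewrite ec.
  transitivity (u ^+ 2 * (u * s0) * a +
    (u * (u ^+ 2 * s1) + u ^+ 2 * (u * s0)) * b); first by ring.
  by rewrite f1 e0; ring.
move: g1 g2 g3 => /eqP; rewrite -subr_eq0 => /eqP g1 /eqP.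
rewrite -subr_eq0 => /eqP g2 /eqP; rewrite -subr_eq0 => /eqP g3.
(* The determinant of the cleared system is [u ^+ 2] times the denominator sought; the factor
   [u ^+ 3] of [c] in [g3] makes this [u ^+ 5]. *)
apply: (mulrI (unitrX 5 uU)); apply/eqP; rewrite -subr_eq0; apply/eqP.
pose E : R := 5 * q ^+ 2 - 3 * q ^+ 3.
pose B : R := u ^+ 3 - (2 * q + q ^+ 2 - q ^+ 3).
pose C : R := u ^+ 3 + q ^+ 2 * u.
pose G : R := q * u ^+ 2.
pose H : R := q * u + q * u ^+ 2.
(* Cramer's rule *)
have -> : u ^+ 5 * ((1 - 6 * q + 8 * q ^+ 2 - q ^+ 3) * c)
    - u ^+ 5 * (q * (1 - 3 * q + q ^+ 2))
  = (C * B + q * u * E) * (u ^+ 3 * c - (G * a + H * b))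
    + G * (B * (u ^+ 3 * a - (u ^+ 3 - q ^+ 2 * u * a - E * b))
           - E * (u ^+ 3 * b - (q * u * a + (2 * q + q ^+ 2 - q ^+ 3) * b)))
    + H * (q * u * (u ^+ 3 * a - (u ^+ 3 - q ^+ 2 * u * a - E * b))
           + C * (u ^+ 3 * b - (q * u * a + (2 * q + q ^+ 2 - q ^+ 3) * b))).
  by rewrite /E /B /C /G /H /u; ring.
by rewrite g1 g2 g3 !mulr0 subrr addr0 !mulr0 !addr0.
Qed.

(** * The recurrence for the counts and its power series *)

Lemma fcoefD (R : comNzRingType) (a b : fps R) n :
  fcoef (a + b) n = fcoef a n + fcoef b n.
Proof. by []. Qed.

Lemma fcoefN (R : comNzRingType) (a : fps R) n : fcoef (- a) n = - fcoef a n.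
Proof. by []. Qed.

Lemma fcoefM (R : comNzRingType) (a b : fps R) n :
  fcoef (a * b) n = \sum_(i < n.+1) fcoef a i * fcoef b (n - i)%N.
Proof. by []. Qed.

Lemma fcoef_mulX (R : comNzRingType) (a : fps R) n :
  fcoef (fpsX R * a) n = if n is m.+1 then fcoef a m else 0.
Proof.
rewrite fcoefM; case: n => [|n]; first by rewrite big_ord1 mul0r.
rewrite big_ord_recl mul0r add0r big_ord_recl mul1r big1 ?addr0 //=.
  by rewrite subSS subn0.
by move=> i _; rewrite mul0r.
Qed.

(* The number of ways to append columns with n cells in all to a column with l
   adjacent cells on its right; f is fuel. *)
Fixpoint tail_count (f n l : nat) : nat :=
  if n is 0 then 1 else if f is f'.+1 then
    (\sum_(k < n.+1 | 0 < k) ((l + k).-1 * tail_count f' (n - k) k.+1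
       + k.-1 * ((l - 2) * tail_count f' (n - k) k.+2)))%N
  else 0.

Lemma tail_count_fuel f g n l : (n <= f)%N -> (n <= g)%N ->
  tail_count f n l = tail_count g n l.
Proof.
elim: f g n l => [|f IH] [|g] [|n] l //= nf ng.
apply: eq_bigr => -[[|k] /= kn] _ //.
by rewrite !(IH g) //; lia.
Qed.

(** The first column is connected, so with k cells it has k + 1 adjacent cells on its right. *)
Definition class_count n : nat :=
  (\sum_(k < n.+1 | 0 < k) tail_count n (n - k) k.+1)%N.

(** The factor [(0 < k)%N%:R] lets the sum start at k = 0, which makes it a convolution; [1 < l]
    keeps [l - 2] from being truncated. *)
Lemma tail_countE n l : (0 < n)%N -> (1 < l)%N ->
  (tail_count n n l)%:R =
    \sum_(k < n.+1) ((0 < k)%N%:R * (l%:R + k%:R - 1) * (tail_count (n - k) (n - k) k.+1)%:R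
      + (0 < k)%N%:R * (k%:R - 1) * (l%:R - 2) * (tail_count (n - k) (n - k) k.+2)%:R) :> int.
Proof.
case: n => // n _ l2; rewrite [tail_count _ _ _]/= natr_sum big_mkcond /=.
apply: eq_bigr => -[[|k] /= kn] _; first by rewrite !mul0r addr0.
rewrite !(@tail_count_fuel n (n.+1 - k.+1)) ?leqnn //; try lia.
rewrite natrD !natrM natrB // mul1r addnS /= natrD -natr1; ring.
Qed.

Lemma class_count_gf (q := fpsX int) :
  (1 - 6 * q + 8 * q ^+ 2 - q ^+ 3) * Fps (fun n => (class_count n)%:Z)
  = q * (1 - 3 * q + q ^+ 2).
Proof.
pose T n l : int := (tail_count n n l)%:R.
(* The slope and the intercept of l |-> T n l, read off from l = 2 and l = 3. *)
pose be : fps int := Fps (fun n => T n 3%N - T n 2%N).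
pose al : fps int := Fps (fun n => 3 * T n 2%N - 2 * T n 3%N).
pose s0 : fps int := Fps (fun k => (0 < k)%N%:R).
pose s1 : fps int := Fps (fun k => k%:R).
pose s2 : fps int := Fps (fun k => k%:R ^+ 2).
(* By [tail_countE] the count is affine in [l], hence equal to its interpolation from two values;
   for [n = 0] it is constant. *)
have TE n l : (1 < l)%N -> T n l = fcoef al n + l%:R * fcoef be n.
  move=> l2 /=; case: n => [|n]; first by rewrite /T /=; ring.
  rewrite /T !tail_countE // !mulr_sumr -!sumrB !mulr_sumr -!big_split.
  by apply: eq_bigr => k _ /=; ring.
have fc1 n : fcoef (1 : fps int) n = (n == 0%N)%:R by [].
have two (a : fps int) : 2 * a = a + a by rewrite mulr2n mulrDl mul1r.
have three (a : fps int) : 3 * a = a + a + a by ring.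
apply: (@linear_system_solution _ q s0 s1 s2 al be).
- apply: fps_unit1; by rewrite fcoefD fcoefN.
- apply: fpsP => -[|n]; rewrite mulrBl mul1r fcoefD fcoefN fcoef_mulX //=.
  by case: n => [|n] /=; ring.
- apply: fpsP => -[|n]; rewrite mulrBl mul1r fcoefD fcoefN fcoef_mulX //=.
  by rewrite -natr1; ring.
- apply: fpsP => -[|n]; rewrite mulrBl mul1r two !fcoefD !fcoefN fcoef_mulX //=.
  by rewrite -natr1; ring.
- apply: fpsP => -[|n]; rewrite fcoefD two !fcoefM.
    by rewrite !big_ord1 /= /T /=; ring.
  rewrite [LHS]/= /T !tail_countE // -sumrB.
  transitivity (\sum_(k < n.+2) (k%:R * fcoef al (n.+1 - k) +
     (k%:R ^+ 2 + (k%:R + k%:R) - (0 < k)%N%:R) * fcoef be (n.+1 - k)));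
    last by rewrite big_split.
  apply: eq_bigr => -[[|k] kn] _; rewrite [nat_of_ord _]/=.
    by rewrite ltnn -[nat_of_bool false]/0%N; ring.
  rewrite -!/(T _ _) !TE // -!natr1.
  by move: (fcoef al _) (fcoef be _) => a b; ring.
(* All counts are 1 at n = 0, so the intercept is 1 there: this is the constant term of the
   equation. *)
- apply: fpsP => -[|n]; rewrite !fcoefD !fcoefN fc1 three two !fcoefM.
    by rewrite !big_ord1 /= /T /=; ring.
  rewrite [LHS]/= /T !tail_countE // !mulr_sumr -sumrB add0r.
  transitivity (- \sum_(k < n.+2) ((k%:R - (0 < k)%N%:R) * fcoef al (n.+1 - k) +
     (k%:R ^+ 2 + (k%:R + k%:R) - ((0 < k)%N%:R + (0 < k)%N%:R + (0 < k)%N%:R))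
       * fcoef be (n.+1 - k))); last by rewrite big_split opprD.
  rewrite -sumrN; apply: eq_bigr => -[[|k] kn] _; rewrite [nat_of_ord _]/=.
    by rewrite ltnn -[nat_of_bool false]/0%N; ring.
  rewrite -!/(T _ _) !TE // -!natr1.
  by move: (fcoef al _) (fcoef be _) => a b; ring.
- apply: fpsP => n; rewrite fcoefD !fcoefM.
  transitivity (\sum_(k < n.+1) ((0 < k)%N%:R * fcoef al (n - k) +
     (k%:R + (0 < k)%N%:R) * fcoef be (n - k))); last by rewrite big_split.
  rewrite [LHS]/= -natz natr_sum big_mkcond.
  apply: eq_bigr => -[[|k] kn] _; rewrite [nat_of_ord _]/=.
    by rewrite ltnn /= add0r !mul0r addr0.
  rewrite ltn0Sn (@tail_count_fuel _ (n - k.+1)) ?leqnn //; last by lia.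
  rewrite -/(T _ _) TE // -!natr1.
  by move: (fcoef al _) (fcoef be _) => a b; ring.
Qed.

(** * Enumeration of the sequences of columns *)

Definition strip_reach (d : strip) : nat :=
  (d.1.2 + if d.2 is 0 then 1 else d.2.+2)%N.

(** The cells adjacent to [d] on its right have heights from [d.1.1 - 1] on and number
    [strip_reach d]. In the first list the bottom of a connected column varies. In the second,
    [d.1.1 + i] is the height of the gap, which avoids the two extreme adjacent cells, and [a] is
    the size of the lower component. *)
Definition next_strips (d : strip) (k : nat) : seq strip :=
  [seq (d.1.1 - k%:Z + i%:Z, k, 0%N) | i <- iota 0 (strip_reach d + k).-1] ++
  [seq (d.1.1 + i%:Z - a%:Z, a, (k - a)%N) | a <- iota 1 k.-1, i <- iota 0 (strip_reach d - 2)].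

Lemma in_next_strips d k (e : strip) : (0 < k)%N ->
  (e \in next_strips d k) = link d e && (strip_size e == k).
Proof.
move=> k0; case: d e => [[l a] b] [[l' a'] b']; rewrite mem_cat /link /strip_size /strip_top /=.
apply/orP/andP => [[/mapP[i]|/allpairsPdep[c [i []]]]|].
- rewrite mem_iota /strip_reach /= => il [-> -> ->]; split; last by lia.
  by case: (b) il => [|?]; lia.
- rewrite !mem_iota /strip_reach /= => ck il [-> -> ->].
  have -> : (k - c = (k - c).-1.+1)%N by lia.
  by move: il; case: (b) => [|?]; lia.
case: b' => [|b'] [lk /eqP kE].
  left; apply/mapP; exists `|(l' - l + k%:Z)%R|%N.
    by rewrite mem_iota /strip_reach /=; case: (b) lk => [|?]; lia.
  by congr (_, _, _); lia.
right; apply/allpairsPdep; exists a', `|(l' - l + a'%:Z)%R|%N.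
rewrite !mem_iota /strip_reach /=; split; first by lia.
  by case: (b) lk => [|?]; lia.
by congr (_, _, _); lia.
Qed.

Lemma uniq_next_strips d k : uniq (next_strips d k).
Proof.
rewrite cat_uniq map_inj_uniq ?iota_uniq /=; last by move=> i j []; lia.
apply/andP; split.
  apply/hasPn => e /allpairsPdep[a [i []]]; rewrite mem_iota => ak _ ->.
  by apply/mapP => -[j _ []]; lia.
apply: allpairs_uniq_dep; rewrite ?iota_uniq //.
by move=> [a i] [c j] _ _ /= [e1 ac e2]; subst c; congr existT; lia.
Qed.

Lemma link_size d e : link d e -> (0 < strip_size e)%N.
Proof. by case: e => -[l a] b; rewrite /link /strip_size => /andP[a0 _] /=; lia. Qed.

Definition next_upto (d : strip) (n : nat) : seq strip :=
  [seq e | k <- iota 1 n, e <- next_strips d k].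

Lemma in_next_upto d n (e : strip) :
  (e \in next_upto d n) = link d e && (strip_size e <= n)%N.
Proof.
apply/allpairsPdep/andP => [[k [e' []]]|[lk en]].
  rewrite mem_iota => kn; rewrite in_next_strips; last by lia.
  by move=> /andP[lk /eqP kE] ->; split=> //; lia.
have e0 := link_size _ _ lk.
exists (strip_size e), e; split=> //; first by rewrite mem_iota e0 ltnS.
by rewrite in_next_strips // lk eqxx.
Qed.

Lemma uniq_next_upto d n : uniq (next_upto d n).
Proof.
apply: allpairs_uniq_dep; rewrite ?iota_uniq //.
  by move=> k _; exact: uniq_next_strips.
(* The size of a strip tells from which list it comes, so the lists for different [k] are
   disjoint. *)
have key (p : {_ : nat & strip}) :
    p \in [seq existT (fun=> strip) k e | k <- iota 1 n, e <- next_strips d k] ->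
    tag p = strip_size (tagged p).
  move=> /allpairsPdep[k [e [+ + pE]]]; rewrite {}pE mem_iota /= => kn.
  rewrite in_next_strips; last by case/andP: kn.
  by case/andP=> _ /eqP ->.
move=> p p' /key pE /key p'E /= pp'.
by case: p p' pE p'E pp' => [k e] [k' e'] /= -> -> ->.
Qed.

(** Same recursion and same fuel as [tail_count], with the sequences themselves. *)
Fixpoint tails (f : nat) (d : strip) (n : nat) : seq (seq strip) :=
  if n is 0 then [:: [::]] else if f is f'.+1 then
    [seq e :: t | e <- next_upto d n, t <- tails f' e (n - strip_size e)]
  else [::].

(** Linked strips have positive size, so fuel [n] suffices and only the empty sequence has total
    size 0. *)
Lemma in_tails f d n (s : seq strip) : (n <= f)%N ->
  (s \in tails f d n) = path link d s && (sumn (map strip_size s) == n).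
Proof.
elim: f d n s => [|f IH] d [|n] s nf //=.
- rewrite inE; case: s => //= e s; apply/esym/negP => /andP[/andP[/link_size e0 _] /eqP]; lia.
- rewrite inE; case: s => //= e s; apply/esym/negP => /andP[/andP[/link_size e0 _] /eqP]; lia.
apply/allpairsPdep/andP => [[e [t []]]|].
  rewrite in_next_upto => /andP[lk en].
  have := link_size _ _ lk => e0; rewrite IH; last by lia.
  by move=> /andP[pt /eqP tE] -> /=; rewrite lk pt tE; split=> //; lia.
case: s => [[_ /eqP] //|e t /= [/andP[lk pt] /eqP tE]].
have := link_size _ _ lk => e0.
exists e, t; split=> //; first by rewrite in_next_upto lk; lia.
by rewrite IH ?pt; lia.
Qed.

Lemma uniq_tails f d n : uniq (tails f d n).
Proof.
elim: f d n => [|f IH] d [|n] //=.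
apply: allpairs_uniq_dep => //; first exact: uniq_next_upto.
by move=> [e t] [e' t'] _ _ /= [-> ->].
Qed.

Lemma sum_ord_positive n (F : nat -> nat) :
  (\sum_(k < n.+1 | 0 < k) F k = \sum_(k <- iota 1 n) F k)%N.
Proof.
rewrite -(big_mkord (fun k => 0 < k)%N F) big_ltn_cond //= /index_iota subn1 /=.
rewrite [RHS]big_seq [LHS]big_seq_cond; apply: eq_bigl => k.
by rewrite mem_iota andb_idr // => /andP[].
Qed.

(** The possible continuations are as many for all strips of equal [strip_reach], and an appended
    strip of k cells has reach k + 1 or k + 2. *)
Lemma size_tails f d n : size (tails f d n) = tail_count f n (strip_reach d).
Proof.
elim: f d n => [|f IH] d [|n] //=.
rewrite size_allpairs_dep sumnE big_map /next_upto big_allpairs_dep.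
rewrite (sum_ord_positive n.+1 (fun k => (strip_reach d + k).-1 * tail_count f (n.+1 - k) k.+1
  + k.-1 * ((strip_reach d - 2) * tail_count f (n.+1 - k) k.+2))%N).
apply: eq_big_seq => k; rewrite mem_iota => kn.
rewrite big_cat big_map /= big_allpairs_dep; congr addn.
  rewrite (eq_bigr (fun=> tail_count f (n.+1 - k) k.+1)).
    by rewrite big_const_seq iter_addn_0 count_predT size_iota mulnC.
  by move=> i _; rewrite IH /strip_size /strip_reach /= addn0 addn1.
rewrite (eq_big_seq (fun=> (strip_reach d - 2) * tail_count f (n.+1 - k) k.+2)%N).
  by rewrite big_const_seq iter_addn_0 count_predT size_iota mulnC.
move=> a; rewrite mem_iota => ak.
rewrite (eq_bigr (fun=> tail_count f (n.+1 - k) k.+2)).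
  by rewrite big_const_seq iter_addn_0 count_predT size_iota mulnC.
move=> i _; rewrite IH /strip_size /strip_reach /=.
have -> : (a + (k - a) = k)%N by lia.
have -> : (k - a = (k - a).-1.+1)%N by lia.
by congr tail_count; lia.
Qed.

(** One representative per translation class: the first column has its lowest cell at height 0. *)
Definition codes (n : nat) : seq (seq strip) :=
  [seq (0, k, 0%N) :: t | k <- iota 1 n, t <- tails n (0, k, 0%N) (n - k)].

Lemma size_codes n : size (codes n) = class_count n.
Proof.
rewrite size_allpairs_dep sumnE big_map.
rewrite /class_count (sum_ord_positive n (fun k => tail_count n (n - k) k.+1)).
by apply: eq_bigr => k _; rewrite size_tails /strip_reach /= addn1.
Qed.

Lemma uniq_codes n : uniq (codes n).
Proof.
apply: allpairs_uniq_dep; rewrite ?iota_uniq //.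
  by move=> k _; exact: uniq_tails.
by move=> [k t] [k' t'] _ _ /= [-> ->].
Qed.

Lemma codesP n s : s \in codes n <-> exists a t,
  [/\ (0 < a)%N, path link (0, a, 0%N) t, s = (0, a, 0%N) :: t &
      sumn (map strip_size s) = n].
Proof.
split=> [/allpairsPdep[k [t []]]|[a [t [a0 pt -> tE]]]].
  rewrite mem_iota => kn; rewrite in_tails; last by lia.
  move=> /andP[pt /eqP tE] ->; exists k, t; split=> //; first by lia.
  by rewrite /= tE /strip_size /=; lia.
rewrite /= {1}/strip_size /= in tE.
apply/allpairsPdep; exists a, t; split=> //; first by rewrite mem_iota; lia.
by rewrite in_tails ?pt /=; lia.
Qed.

(** * Translation classes and their codes *)

Lemma shift0 d : shift 0 d = d.
Proof. by case: d => -[l a] b; rewrite /shift /= addr0. Qed.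

Lemma shiftD v w d : shift v (shift w d) = shift (w + v) d.
Proof. by rewrite /shift /= addrA. Qed.

Lemma link_shift w : {mono shift w : d e / link d e}.
Proof.
case=> -[l a] b [[l' a'] b']; rewrite /link /strip_top /=.
by case: b b' => [|b] [|b']; lia.
Qed.

(** A translation between the two polyominoes has to preserve the leftmost stack and the lowest cell
    in it, so it is trivial and [decode_inj] applies. *)
Lemma translation_class_decode_inj n :
  {in codes n &, injective (fun s => translation_class (decode 0 s))}.
Proof.
move=> _ _ /codesP[a [t [a0 pt -> _]]] /codesP[b [u [b0 pu -> _]]].
move=> /translate_class_eq[[v w]]; set d : strip := (0, a, 0%N); set e : strip := (0, b, 0%N).
rewrite translate_decode add0r -[map _ _]/(shift w e :: map (shift w) u) => E.
have pos_d : all_positive (d :: t) by rewrite /= a0 (path_link_positive _ _ pt).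
have pos_e : all_positive (shift w e :: map (shift w) u).
  rewrite /= b0 /=; have := path_link_positive _ _ pu.
  by rewrite /all_positive all_map; apply: sub_all.
have in_d : (0, 0) \in decode 0 (d :: t).
  by rewrite in_decode_cons in_strip_cells /=; lia.
have in_e : (v, w) \in decode v (shift w e :: map (shift w) u).
  by rewrite in_decode_cons in_strip_cells /=; lia.
have v0 : v = 0.
  rewrite -E in in_e; rewrite E in in_d.
  by have /= := decode_ge _ _ _ in_d; have /= := decode_ge _ _ _ in_e; lia.
rewrite v0 in E; have [w0 ab ->] := decode_inj _ _ _ pos_d pos_e E.
have -> : w = 0 by lia.
by rewrite /d /e ab (eq_map shift0) map_id.
Qed.

(** Each class contains the translate whose first column starts at [(0, 0)]. The right-hand side is
    visibly finite, as [fset_set] requires. *)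
Lemma cheesy_classesE n :
  cheesy_classes 1 n =
  [set` [fset T in [seq translation_class (decode 0 s) | s <- codes n]]%fset]%classic.
Proof.
apply/seteqP; split=> [_ [P [/cheesy_decodable[x [l [a [s [a0 ps ->]]]]] cardP] <-]|T] /=.
  rewrite inE; apply/mapP; exists (map (shift (- l)) ((l, a, 0%N) :: s)).
    apply/codesP; exists a, (map (shift (- l)) s); split=> //.
    - rewrite -(addrN l) -[(_, a, 0%N)]/(shift (- l) (l, a, 0%N)).
      by rewrite path_map (eq_path (link_shift _)).
    - by rewrite map_cons /shift /= subrr.
    by rewrite -cardP card_decode -map_comp.
  apply/translate_class_eq; exists (x, l); rewrite translate_decode add0r -map_comp.
  by rewrite (eq_map (g := id)) ?map_id // => d; rewrite /= shiftD addNr shift0.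
rewrite inE => /mapP[s /codesP[a [t [a0 pt -> tE]]] ->].
exists (decode 0 ((0, a, 0%N) :: t)) => //; split; first exact: cheesy_decode.
by rewrite card_decode.
Qed.

Theorem proposition2 :
  let q : fps int := fpsX int in
  cheesy_gf 1 = q * (1 - 3 * q + q ^+ 2) / (1 - 6 * q + 8 * q ^+ 2 - q ^+ 3).
Proof.
move=> q; rewrite -class_count_gf mulrC mulKr; last first.
  (* Factoring out [q] shows that the constant coefficient is 1, so the denominator is
     invertible. *)
  have -> : 1 - 6 * q + 8 * q ^+ 2 - q ^+ 3 = 1 - q * (6 - 8 * q + q ^+ 2) by ring.
  by apply: fps_unit1; rewrite fcoefD fcoefN fcoef_mulX subr0.
apply: fpsP => n /=; rewrite cheesy_classesE set_fsetK card_fseq undup_id.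
  by rewrite size_map size_codes.
by rewrite map_inj_in_uniq ?uniq_codes //; exact: translation_class_decode_inj.
Qed.
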